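(* Let $V$ be a smooth scheme over a field, let $\mathcal{G}=\bigoplus_n I_nW^n$ be a Rees algebra over $V$, let $x\in\mathrm{Sing}(\mathcal{G})$, and suppose that $\mathcal{G}$ is defined locally at $x$ by the set of generators $\{f_1W^{n_1},\dots,f_sW^{n_s}\}$ with all $n_i\ge1$, i.e. $\mathcal{G}=\mathcal{O}_{V,x}[f_1W^{n_1},\dots,f_sW^{n_s}]$ at $x$. Then $$\mathbb{I}_{\mathcal{G},x}=\langle \mathrm{In}_{n_1}(f_1),\dots,\mathrm{In}_{n_s}(f_s)\rangle .$$
   Context: A Rees algebra over a smooth scheme $V$ is a graded subalgebra $\mathcal{G}=\bigoplus_{n\ge 0} I_nW^n$ of $\mathcal{O}_V[W]$ ($W$ a dummy variable), where the $I_n$ are sheaves of ideals with $I_0=\mathcal{O}_V$ and $I_sI_t\subset I_{s+t}$, which is locally a finitely generated $\mathcal{O}_V$-algebra. The singular locus is $\mathrm{Sing}(\mathcal{G})=\{x\in V : \nu_x(I_n)\ge n \text{ for all } n\ge 1\}$, with $\nu_x(I_n)$ the order of $I_n$ at $\mathcal{O}_{V,x}$. For $f\in\mathfrak{M}_x^n$, where $\mathfrak{M}_x$ is the maximal ideal of $\mathcal{O}_{V,x}$, $\mathrm{In}_n(f)$ denotes the class of $f$ in $\mathfrak{M}_x^n/\mathfrak{M}_x^{n+1}$ (possibly zero). $\mathbb{I}_{\mathcal{G},x}$ is the homogeneous ideal of $gr_{\mathfrak{M}_x}(\mathcal{O}_{V,x})$ generated by the classes $\mathrm{In}_n(f)$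 of all $f\in I_n$ (at $x$), for all $n\ge1$. *)

(* Defs.v *)
From HB Require Import structures.
From mathcomp Require Import all_boot all_order all_algebra.
From mathcomp Require Import generic_quotient ring_quotient.
From mathcomp Require Import boolp classical_sets functions topology.

Set Implicit Arguments.
Unset Strict Implicit.
Unset Printing Implicit Defensive.

Import GRing.Theory.
Local Open Scope classical_set_scope.
Local Open Scope ring_scope.

Section Ideals.
Variable A : comPzRingType.
Implicit Types (I S : set A) (a b : A).

Definition is_ideal I : Prop :=
  [/\ I 0, forall a b, I a -> I b -> I (a + b) & forall c a, I a -> I (c * a)].

Definition is_prime_ideal I : Prop :=
  [/\ is_ideal I, ~ I 1 & forall a b, I (a * b) -> I a \/ I b].

Definition ideal_gen S : set A := smallest is_ideal S.

Fixpoint ideal_pow I (n : nat) : set A :=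
  if n is m.+1 then ideal_gen [set a * b | a in I & b in ideal_pow I m]
  else setT.

Lemma ideal_gen_ideal S : is_ideal (ideal_gen S).
Proof.
split=> [I [[] //]|a b Ia Ib I IS|c a Ia I IS].
  by have [[_ D _] _] := IS; apply: D; [exact: Ia|exact: Ib].
by have [[_ _ M] _] := IS; apply: M; exact: Ia.
Qed.

Lemma ideal_pow_ideal I n : is_ideal (ideal_pow I n).
Proof. by case: n => [|n]; [split|exact: ideal_gen_ideal]. Qed.

Lemma ideal_powM I m n a b :
  ideal_pow I m a -> ideal_pow I n b -> ideal_pow I (m + n) (a * b).
Proof.
elim: m a => [|m IH] a /=.
  by move=> _ Ib; have [_ _ M] := ideal_pow_ideal I n; exact: M.
move=> Ia Ib; apply: (Ia [set c | ideal_pow I (m + n).+1 (c * b)]); split.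
  have [I0 ID IM] := ideal_pow_ideal I (m + n).+1.
  split=> [|c d Ic Id|c d Id] /=; first by rewrite mul0r; exact: I0.
    by rewrite mulrDl; exact: ID.
  by rewrite -mulrA; exact: IM.
move=> _ [c Ic [d Id <-]] /= J [_]; apply.
by exists c => //; exists (d * b); [exact: IH|rewrite mulrA].
Qed.

End Ideals.

Definition subalg_gen (R : comNzRingType) (S : set {poly R}) : set {poly R} :=
  smallest [set B | GRing.subalg_closed [in B]] S.

HB.mixin Record isLocalRing R & GRing.ComUnitRing R := {
  nonunitD : forall a b : R, a \isn't a GRing.unit -> b \isn't a GRing.unit ->
    a + b \isn't a GRing.unit
}.

#[short(type="localRingType")]
HB.structure Definition LocalRing := {R of GRing.ComUnitRing R & isLocalRing R}.

(* The associated graded ring of a local ring R with maximal ideal M is        *)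
(* constructed as the quotient of \bigoplus_n M^n W^n, a subring of R[W],      *)
(* by its ideal \bigoplus_n M^(n+1) W^n.                                       *)
Section AssociatedGraded.
Variable R : localRingType.

Definition max_ideal : set R := [set a | a \isn't a GRing.unit].

Definition mpow (n : nat) : set R := ideal_pow max_ideal n.

Lemma mpow_sum (I : Type) (r : seq I) (P : pred I) (F : I -> R) n :
  (forall i, P i -> mpow n (F i)) -> mpow n (\sum_(i <- r | P i) F i).
Proof.
by move=> PF; elim/big_ind: _ => //; have [] := ideal_pow_ideal max_ideal n.
Qed.

Lemma mpowM m n a b : mpow m a -> mpow n b -> mpow (m + n) (a * b).
Proof. exact: ideal_powM. Qed.

Lemma mpow1 a : mpow 1 a -> max_ideal a.
Proof.
apply; split=> [|_ [c cM [d _ <-]]] /=; last first.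
  by rewrite /max_ideal /= unitrM (negPf cM).
split=> [|c d|c d]; rewrite /max_ideal /= ?unitr0 //; first exact: nonunitD.
by rewrite unitrM andbC => /negPf ->.
Qed.

Definition mrees_pred : {pred {poly R}} :=
  [pred p : {poly R} | `[< forall n, mpow n p`_n >]].

Lemma mrees_subring : subring_closed mrees_pred.
Proof.
split=> [|p q /asboolP pM /asboolP qM|p q /asboolP pM /asboolP qM].
- apply/asboolP => n; rewrite coef1.
  by case: n => [|n] //; have [] := ideal_pow_ideal max_ideal n.+1.
- apply/asboolP => n; rewrite coefB.
  have [_ D M] := ideal_pow_ideal max_ideal n.
  by apply: D; [exact: pM|rewrite -mulN1r; apply: M; exact: qM].
- apply/asboolP => n; rewrite coefM; apply: mpow_sum => i _.
  rewrite -[n in mpow n](@subnKC i) -1?ltnS //.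
  by apply: mpowM; [exact: pM|exact: qM].
Qed.

HB.instance Definition _ :=
  GRing.isSubringClosed.Build {poly R} mrees_pred mrees_subring.

Record mrees := MRees { mrees_val : {poly R}; _ : mrees_val \in mrees_pred }.

HB.instance Definition _ := [isSub for mrees_val].
HB.instance Definition _ := [Choice of mrees by <:].
HB.instance Definition _ := [SubChoice_isSubComNzRing of mrees by <:].

Definition mrees_shift : {pred mrees} :=
  [pred p : mrees | `[< forall n, mpow n.+1 (mrees_val p)`_n >]].

Lemma mrees_shift_ideal : idealr_closed mrees_shift.
Proof.
have v0 : mrees_val 0 = 0 := raddf0 (\val : mrees -> {poly R}).
have v1 : mrees_val 1 = 1 := rmorph1 (\val : mrees -> {poly R}).
have vD p q : mrees_val (p + q) = mrees_val p + mrees_val q :=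
  raddfD (\val : mrees -> {poly R}) p q.
have vM p q : mrees_val (p * q) = mrees_val p * mrees_val q :=
  rmorphM (\val : mrees -> {poly R}) p q.
split.
- apply/asboolP => n; rewrite v0 coef0.
  by have [] := ideal_pow_ideal max_ideal n.+1.
- apply/asboolP => /(_ 0%N); rewrite v1 coef1.
  by move/mpow1; rewrite /max_ideal /= unitr1.
- move=> p q r /asboolP qM /asboolP rM; apply/asboolP => n.
  rewrite vD coefD vM coefM.
  have [_ D _] := ideal_pow_ideal max_ideal n.+1; apply: D; last exact: rM.
  rewrite -[ideal_pow _ _]/(mpow _).
  apply: mpow_sum => i _.
  rewrite -[n in mpow n.+1](@subnKC i) -1?ltnS // -addnS.
  apply: mpowM; last exact: qM.
  by case: p => p /= /asboolP; apply.
Qed.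

HB.instance Definition _ := isIdealr.Build mrees mrees_shift mrees_shift_ideal.

Definition gr : comNzRingType := {ideal_quot mrees_shift}.

(* In_n(f); meaningful when f is in M^n, and 0 by default otherwise.           *)
Definition initial_form (n : nat) (f : R) : gr :=
  \pi_({ideal_quot mrees_shift})%qT (insubd (0 : mrees) (f *: 'X^n)).

(* The largest n with J included in M^n; None stands for infinity.             *)
Definition ideal_order (J : set R) : option nat :=
  match pselect (exists n, `[< ~ J `<=` mpow n.+1 >]) with
  | left h => Some (ex_minn h)
  | right _ => None
  end.

End AssociatedGraded.

Definition le_order (n : nat) (o : option nat) : bool :=
  if o is Some m then (n <= m)%N else true.

Identity Coercion fun_of_set : set >-> Funclass.

Record opens (T : topologicalType) := Opens {
  open_set :> set T;
  open_setP : open open_set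
}.

Definition opensT (T : topologicalType) : opens T := Opens openT.

(* A locally ringed space. The stalks are part of the data, characterized by   *)
(* germ_res, germ_surj and germ_eq0 as the filtered colimits of the rings of   *)
(* sections over the open neighbourhoods.                                      *)
Record lrSpace := LRSpace {
  lr_points :> topologicalType;
  sec : opens lr_points -> comPzRingType;
  res : forall U V : opens lr_points, V `<=` U -> {rmorphism sec U -> sec V};
  res_id : forall (U : opens lr_points) (UU : U `<=` U) (s : sec U),
    res UU s = s;
  res_comp : forall (U V W : opens lr_points)
    (VU : V `<=` U) (WV : W `<=` V) (WU : W `<=` U) (s : sec U),
    res WV (res VU s) = res WU s;
  sec_glue : forall (U : opens lr_points) (I : Type) (V : I -> opens lr_points)
    (VU : forall i, V i `<=` U) (s : forall i, sec (V i)),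
    U `<=` \bigcup_i V i ->
    (forall i j (W : opens lr_points) (Wi : W `<=` V i) (Wj : W `<=` V j),
      res Wi (s i) = res Wj (s j)) ->
    exists! t : sec U, forall i, res (VU i) t = s i;
  stalk : lr_points -> localRingType;
  germ : forall (U : opens lr_points) (x : lr_points),
    U x -> {rmorphism sec U -> stalk x};
  germ_res : forall (U V : opens lr_points) (VU : V `<=` U) (x : lr_points)
    (Ux : U x) (Vx : V x) (s : sec U), germ Vx (res VU s) = germ Ux s;
  germ_surj : forall (x : lr_points) (a : stalk x),
    exists (U : opens lr_points) (Ux : U x) (s : sec U), germ Ux s = a;
  germ_eq0 : forall (U : opens lr_points) (x : lr_points) (Ux : U x)
    (s : sec U), germ Ux s = 0 ->
    exists (V : opens lr_points) (VU : V `<=` U), V x /\ res VU s = 0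
}.

(* g : A -> B exhibits B as the ring of fractions A_f.                         *)
Definition is_localization (A B : comPzRingType) (f : A)
    (g : {rmorphism A -> B}) : Prop :=
  [/\ exists b, g f * b = 1,
      forall b, exists (a : A) (n : nat), b * g f ^+ n = g a
    & forall a, g a = 0 -> exists n : nat, f ^+ n * a = 0].

(* (U, O|U) is isomorphic to Spec A with A = O(U): phi is a homeomorphism from *)
(* U to the set of primes of A with the Zariski topology, whose open sets are  *)
(* the {p | ~ S `<=` p}, and A -> O(D(f)) is the localization A -> A_f.        *)
Definition affine_open (X : lrSpace) (U : opens X) : Prop :=
  exists phi : X -> set (sec U),
  [/\ set_bij U (@is_prime_ideal (sec U)) phi,
      forall W : set X, W `<=` U ->
        (open W <->
         exists S : set (sec U), W = [set y | U y /\ ~ S `<=` phi y])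
    & forall (f : sec U) (W : opens X) (WU : W `<=` U),
        W = [set y | U y /\ ~ phi y f] :> set X ->
        is_localization f (res WU)].

Definition is_scheme (X : lrSpace) : Prop :=
  forall x : X, exists2 U : opens X, U x & affine_open U.

Definition finite_type (k A : comPzRingType) (c : {rmorphism k -> A}) : Prop :=
  exists gens : seq A,
    smallest [set B : set A | subring_closed [in B] /\ range c `<=` B]
      [set` gens] = setT.

(* Unique existence is not required: infinitesimal lifting along surjections   *)
(* with square-zero kernel.                                                    *)
Definition formally_smooth (k A : comPzRingType) (c : {rmorphism k -> A}) :
    Prop :=
  forall (B C : comPzRingType) (b : {rmorphism k -> B}) (p : {rmorphism B -> C}),
    (forall z, exists y, p y = z) ->
    (forall u v, p u = 0 -> p v = 0 -> u * v = 0) ->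
    forall g : {rmorphism A -> C}, g \o c =1 p \o b ->
    exists h : {rmorphism A -> B}, h \o c =1 b /\ p \o h =1 g.

(* A scheme V with a morphism V -> Spec k, i.e. a ring morphism from k to the  *)
(* global sections, which is smooth: locally of finite presentation (over a    *)
(* field, locally of finite type) and formally smooth.                         *)
Record smoothScheme (k : fieldType) := SmoothScheme {
  sch_space :> lrSpace;
  sch_scheme : is_scheme sch_space;
  sch_struct : {rmorphism k -> sec (opensT sch_space)};
  sch_smooth : forall x : sch_space, exists U : opens sch_space,
    [/\ U x, affine_open U,
        finite_type (res (@subsetT _ U : U `<=` opensT _) \o sch_struct)
      & formally_smooth (res (@subsetT _ U : U `<=` opensT _) \o sch_struct)]
}.

Record idealSheaf (X : lrSpace) := IdealSheaf {
  isec :> forall U : opens X, set (sec U);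
  isec_ideal : forall U, is_ideal (@isec U);
  isec_res : forall (U V : opens X) (VU : V `<=` U) (s : sec U),
    isec s -> isec (res VU s);
  isec_local : forall (U : opens X) (s : sec U),
    (forall x, U x -> exists (V : opens X) (VU : V `<=` U),
      V x /\ isec (res VU s)) ->
    isec s
}.

Definition ideal_stalk (X : lrSpace) (I : idealSheaf X) (x : X) :
    set (stalk x) :=
  [set a | exists (U : opens X) (Ux : U x) (s : sec U), I U s /\ germ Ux s = a].
Arguments ideal_stalk {X} I x.

(* The stalk at x of \bigoplus_n I_n W^n, as a subset of O_{X,x}[W].           *)
Definition graded_stalk (X : lrSpace) (I : nat -> idealSheaf X) (x : X) :
    set {poly stalk x} :=
  [set p | forall n, ideal_stalk (I n) x p`_n].
Arguments graded_stalk {X} I x.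

Definition germ_poly (X : lrSpace) (U : opens X) (x : X) (Ux : U x)
    (g : seq (sec U)) : {poly stalk x} :=
  Poly [seq germ Ux s | s <- g].

(* In rees_fg, a section of \bigoplus_n I_n W^n over U is represented by its   *)
(* list of coefficients (O(U)[W] is not available: O(U) may be the zero ring); *)
(* generation as a sheaf of algebras over U is tested on stalks.               *)
Record reesAlgebra (X : lrSpace) := ReesAlgebra {
  rees_ideal :> nat -> idealSheaf X;
  rees_0 : forall U : opens X, rees_ideal 0%N U = setT;
  rees_mul : forall (m n : nat) (U : opens X) (a b : sec U),
    rees_ideal m U a -> rees_ideal n U b -> rees_ideal (m + n)%N U (a * b);
  rees_fg : forall x : X, exists (U : opens X) (gens : seq (seq (sec U))),
    [/\ U x,
        forall g, g \in gens -> forall n, rees_ideal n U g`_n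
      & forall (y : X) (Uy : U y),
          graded_stalk rees_ideal y =
          subalg_gen [set germ_poly Uy g | g in [set` gens]]]
}.

Definition Sing (X : lrSpace) (G : reesAlgebra X) : set X :=
  [set x | forall n : nat, (1 <= n)%N ->
     le_order n (ideal_order (ideal_stalk (G n) x))].
Arguments Sing {X} G.

(* The ideal I_{G,x} of gr(O_{X,x}).                                           *)
Definition initial_ideal (X : lrSpace) (G : reesAlgebra X) (x : X) :
    set (gr (stalk x)) :=
  ideal_gen [set a | exists (n : nat) (f : stalk x),
    [/\ (1 <= n)%N, ideal_stalk (G n) x f & a = initial_form n f]].
Arguments initial_ideal {X} G x.

(* Main.v *)
(* Since x is in Sing(G), every element p of the stalk of G at x has p_n in M^n,
   so its initial forms In_n(p_n) are defined.  As In is additive in each degree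
   and multiplicative across degrees, the p in R[W] whose coefficients of positive
   degree have initial form in a given ideal J of gr(R) form an R-subalgebra: in
   sum_(i + j = n) In_i(p_i) In_j(q_j) with n >= 1, one of i, j is positive.  With
   J the ideal of the In_(n_i)(f_i), this subalgebra contains the generators
   f_i W^(n_i), hence the whole stalk. *)
Require Import Defs.
From mathcomp Require Import all_boot all_order all_algebra.
From mathcomp Require Import generic_quotient ring_quotient.
From mathcomp Require Import boolp classical_sets functions topology.

Set Implicit Arguments.
Unset Strict Implicit.
Unset Printing Implicit Defensive.

Import GRing.Theory.
Local Open Scope classical_set_scope.
Local Open Scope ring_scope.

Lemma ideal_gen_sub (A : comPzRingType) (S J : set A) :
  is_ideal J -> S `<=` J -> ideal_gen S `<=` J.
Proof. by move=> Jid SJ a; apply. Qed.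

Lemma mem_ideal_gen (A : comPzRingType) (S : set A) : S `<=` ideal_gen S.
Proof. exact: sub_smallest. Qed.

Lemma ideal_sum (A : comPzRingType) (J : set A) (I : Type) (r : seq I)
    (P : pred I) (F : I -> A) :
  is_ideal J -> (forall i, P i -> J (F i)) -> J (\sum_(i <- r | P i) F i).
Proof. by case=> J0 JD _ JF; elim/big_ind: _. Qed.

Lemma mem_subalg_gen (R : comNzRingType) (S : set {poly R}) :
  S `<=` subalg_gen S.
Proof. exact: sub_smallest. Qed.

Section InitialForms.
Variable R : localRingType.
Implicit Types (a b : R) (p q : {poly R}).

Lemma mpow_0 n : mpow n (0 : R).
Proof. by have [] := ideal_pow_ideal (@max_ideal R) n. Qed.

Lemma mpowD n a b : mpow n a -> mpow n b -> mpow n (a + b).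
Proof. by have [_ D _] := ideal_pow_ideal (@max_ideal R) n; apply: D. Qed.

Lemma coef_scaleXn a m n : (a *: 'X^m)`_n = if n == m then a else 0.
Proof. by rewrite coefZ coefXn; case: eqP; rewrite ?mulr1 ?mulr0. Qed.

Lemma val_monomial n a :
  mpow n a -> \val (insubd (0 : mrees R) (a *: 'X^n)) = a *: 'X^n.
Proof.
move=> aM; apply: insubdK; apply/asboolP => m; rewrite coef_scaleXn.
by case: eqP => [->|_]; [|exact: mpow_0].
Qed.

Lemma initial_formD n a b : mpow n a -> mpow n b ->
  initial_form n (a + b) = initial_form n a + initial_form n b.
Proof.
move=> aM bM; rewrite /initial_form -rmorphD; congr (\pi%qT _); apply: val_inj.
rewrite raddfD /= !val_monomial ?scalerDl //; exact: mpowD.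
Qed.

Lemma initial_formM m n a b : mpow m a -> mpow n b ->
  initial_form (m + n) (a * b) = initial_form m a * initial_form n b.
Proof.
move=> aM bM; rewrite /initial_form -rmorphM; congr (\pi%qT _); apply: val_inj.
rewrite rmorphM /= !val_monomial //; last exact: mpowM.
by rewrite exprD -scalerAl -scalerAr scalerA.
Qed.

Lemma initial_form0 n : initial_form n (0 : R) = 0.
Proof.
apply: (addrI (initial_form n (0 : R))).
by rewrite -initial_formD ?addr0 //; exact: mpow_0.
Qed.

Lemma initial_form_sum n (I : Type) (r : seq I) (P : pred I) (F : I -> R) :
  (forall i, P i -> mpow n (F i)) ->
  initial_form n (\sum_(i <- r | P i) F i) =
  \sum_(i <- r | P i) initial_form n (F i).
Proof.
move=> FM.
have [] : mpow n (\sum_(i <- r | P i) F i) /\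
  initial_form n (\sum_(i <- r | P i) F i) =
  \sum_(i <- r | P i) initial_form n (F i) => //.
elim/big_rec2: _ => [|i y z Pi [zM <-]].
  by split; [exact: mpow_0|exact: initial_form0].
by split; [apply: mpowD => //; exact: FM|rewrite initial_formD //; exact: FM].
Qed.

Definition initial_forms_in (J : set (gr R)) : set {poly R} :=
  [set p | (forall n, mpow n p`_n) /\
           forall n, (1 <= n)%N -> J (initial_form n p`_n)].

Lemma initial_forms_in_subalg (J : set (gr R)) :
  is_ideal J -> GRing.subalg_closed [in initial_forms_in J].
Proof.
move=> Jid; have [J0 JD JM] := Jid; split.
- apply/mem_set; split=> -[|n] //; rewrite coef1 /=; first exact: mpow_0.
  by move=> _; rewrite initial_form0.
- move=> a p q /set_mem [pM pJ] /set_mem [qM qJ]; apply/mem_set.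
  have aM : mpow 0 a by [].
  have apM n : mpow n (a * p`_n) := mpowM aM (pM n).
  split=> n => [|n1]; rewrite coefD coefZ; first exact: mpowD.
  rewrite initial_formD //; apply: JD; last exact: qJ.
  by rewrite -[n in initial_form n]add0n initial_formM //; apply: JM; exact: pJ.
- move=> p q /set_mem [pM pJ] /set_mem [qM qJ]; apply/mem_set.
  have pqM n (i : 'I_n.+1) : mpow n (p`_i * q`_(n - i)).
    by rewrite -{1}(@subnKC i n) -1?ltnS //; exact: mpowM.
  split=> n => [|n1]; rewrite coefM; first by apply: mpow_sum => i _; exact: pqM.
  rewrite initial_form_sum => [|i _]; last exact: pqM.
  apply: ideal_sum => // i _.
  rewrite -{1}(@subnKC i n) -1?ltnS // initial_formM //.
  have [i0|i_gt0] := posnP i; last by rewrite mulrC; apply: JM; exact: pJ.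
  by apply: JM; apply: qJ; rewrite i0 subn0.
Qed.

Lemma le_order_sub (J : set R) n :
  (1 <= n)%N -> le_order n (ideal_order J) -> J `<=` mpow n.
Proof.
case: n => // n _; rewrite /ideal_order; case: pselect => [h|nh _] /=.
  case: ex_minnP => m _ m_min nm; apply: contrapT => nJ.
  by have := leq_trans nm (m_min n (asboolT nJ)); rewrite ltnn.
by apply: contrapT => nJ; apply: nh; exists n; exact/asboolP.
Qed.

Lemma initial_ideal_generators (I : nat -> set R) (T : Type) (f : T -> R)
    (n : T -> nat) :
  (forall m, I m 0) -> (forall m, (1 <= m)%N -> I m `<=` mpow m) ->
  (forall i, (1 <= n i)%N) ->
  [set p : {poly R} | forall m, I m p`_m] =
    subalg_gen [set f i *: 'X^(n i) | i in [set: T]] ->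
  ideal_gen [set a | exists m g,
    [/\ (1 <= m)%N, I m g & a = initial_form m g]] =
  ideal_gen [set initial_form (n i) (f i) | i in [set: T]].
Proof.
move=> I0 IM n_ge1 gens.
have If i : I (n i) (f i).
  have : subalg_gen [set f i *: 'X^(n i) | i in [set: T]] (f i *: 'X^(n i)).
    by apply: mem_subalg_gen; exists i.
  by rewrite -gens => /(_ (n i)); rewrite coef_scaleXn eqxx.
apply/seteqP; split; apply: ideal_gen_sub; try exact: ideal_gen_ideal; last first.
  by move=> _ [i _ <-]; apply: mem_ideal_gen; exists (n i), (f i).
move=> _ [m [g [m1 Ig ->]]].
set J := ideal_gen _.
have Jid : is_ideal J by exact: ideal_gen_ideal.
have : subalg_gen [set f i *: 'X^(n i) | i in [set: T]] (g *: 'X^m).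
  by rewrite -gens => l; rewrite coef_scaleXn; case: eqP => [->|].
have sub : [set f i *: 'X^(n i) | i in [set: T]] `<=` initial_forms_in J.
  move=> _ [i _ <-]; split=> l; rewrite coef_scaleXn; case: eqP => [->|_].
  - exact: IM.
  - exact: mpow_0.
  - by move=> _; apply: mem_ideal_gen; exists i.
  - by rewrite initial_form0; case: Jid.
move=> /(_ _ (conj (initial_forms_in_subalg Jid) sub)) [_ /(_ m m1)].
by rewrite coef_scaleXn eqxx.
Qed.

End InitialForms.

Theorem lemma5p3 (k : fieldType) (V : smoothScheme k) (G : reesAlgebra V)
    (x : V) (xSing : Sing G x)
    (s : nat) (f : 'I_s -> stalk x) (n : 'I_s -> nat)
    (n_ge1 : forall i, (1 <= n i)%N)
    (gens : graded_stalk G x =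
            subalg_gen [set f i *: 'X^(n i) | i in [set: 'I_s]]) :
  initial_ideal G x =
  ideal_gen [set initial_form (n i) (f i) | i in [set: 'I_s]].
Proof.
apply: (initial_ideal_generators (I := fun m => ideal_stalk (G m) x)) => // m.
  have [G0 _ _] := isec_ideal (G m) (opensT V).
  have Tx : opensT V x by [].
  by exists (opensT V), Tx, 0; split; [|exact: rmorph0].
by move=> m1; apply: le_order_sub => //; exact: xSing.
Qed.
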